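(* Let $(G,M)$ be a marked permutation graph such that $G$ is cyclically 5-edge-connected. Then every edge of $G$ is contained in an $M$-copy of $P_{10}$ in $G$.
   Context: Graphs are finite. $P_{10}$ denotes the Petersen graph. A marked permutation graph is a pair $(G,M)$ where $G$ is a cubic graph and $M$ is a perfect matching of $G$ (a distinguished matching) such that $G-E(M)$ is the disjoint union of two cycles, neither of which has a chord in $G$. An $M$-copy of $P_{10}$ (also written $M$-$P_{10}$) is a subgraph of $G$ that is isomorphic to a subdivision of $P_{10}$ and is composed of the two cycles of $G-E(M)$ together with five edges of $M$. A graph is cyclically 5-edge-connected if it contains no edge-cut of size at most $4$ whose removal leaves at least two components that are not trees. *)

(* Defs.v *)
From mathcomp Require Import all_boot.

Set Implicit Arguments.
Unset Strict Implicit.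
Unset Printing Implicit Defensive.

(* Finite simple graphs. Allowing loops or parallel edges would not change the
   class of graphs considered below: in a cyclically 5-edge-connected marked
   permutation graph the matching is an edge-cut separating the two cycles, so
   both cycles have length at least 5. *)
Record sgraph := SGraph {
  vertex :> finType;
  adj : rel vertex;
  adj_sym : symmetric adj;
  adj_irr : irreflexive adj
}.

Definition edges (G : sgraph) : {set {set G}} :=
  [set [set z.1; z.2] | z in [set z : G * G | adj z.1 z.2]].

Lemma spanning_sym (G : sgraph) (F : {set {set G}}) :
  symmetric (fun x y : G => adj x y && ([set x; y] \in F)).
Proof. by move=> x y; rewrite adj_sym setUC. Qed.

Lemma spanning_irr (G : sgraph) (F : {set {set G}}) :
  irreflexive (fun x y : G => adj x y && ([set x; y] \in F)).
Proof. by move=> x; rewrite adj_irr. Qed.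

Definition spanning_subgraph (G : sgraph) (F : {set {set G}}) : sgraph :=
  SGraph (@spanning_sym G F) (@spanning_irr G F).

Definition del_edges (G : sgraph) (S : {set {set G}}) : sgraph :=
  spanning_subgraph (edges G :\: S).

Lemma induced_sym (G : sgraph) (A : {set G}) :
  symmetric (fun x y : {x : G | x \in A} => adj (val x) (val y)).
Proof. by move=> x y; rewrite adj_sym. Qed.

Lemma induced_irr (G : sgraph) (A : {set G}) :
  irreflexive (fun x y : {x : G | x \in A} => adj (val x) (val y)).
Proof. by move=> x; rewrite adj_irr. Qed.

Definition induced_subgraph (G : sgraph) (A : {set G}) : sgraph :=
  SGraph (@induced_sym G A) (@induced_irr G A).

Definition cubic (G : sgraph) : Prop :=
  forall x : G, #|[set y | adj x y]| = 3.

Definition is_cycle (G : sgraph) (c : seq G) : bool :=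
  [&& 2 < size c, cycle (@adj G) c & uniq c].

Definition cycle_edges (G : sgraph) (c : seq G) : {set {set G}} :=
  [set [set x; next c x] | x in c].

Definition chordless (G : sgraph) (c : seq G) : Prop :=
  forall x y : G, x \in c -> y \in c -> adj x y -> [set x; y] \in cycle_edges c.

Definition perfect_matching (G : sgraph) (M : {set {set G}}) : Prop :=
  M \subset edges G /\ forall x : G, #|[set e in M | x \in e]| = 1.

Definition marked_permutation_graph (G : sgraph) (M : {set {set G}}) : Prop :=
  [/\ cubic G,
      perfect_matching M &
      exists c1 c2 : seq G,
        [/\ is_cycle c1 /\ is_cycle c2,
            [disjoint c1 & c2],
            (forall x : G, (x \in c1) || (x \in c2)),
            edges G :\: M = cycle_edges c1 :|: cycle_edges c2 &
            chordless c1 /\ chordless c2]].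

Definition connected (G : sgraph) : Prop :=
  0 < #|G| /\ forall x y : G, connect (@adj G) x y.

Definition is_tree (G : sgraph) : Prop :=
  connected G /\ forall c : seq G, ~~ is_cycle c.

Definition components (G : sgraph) : {set {set G}} :=
  equivalence_partition (connect (@adj G)) [set: G].

Definition edge_cut (G : sgraph) (X : {set G}) : {set {set G}} :=
  [set e in edges G | (e :&: X != set0) && (e :\: X != set0)].

Definition cyclically_edge_connected (k : nat) (G : sgraph) : Prop :=
  ~ exists X : {set G},
      [/\ X != set0, X != [set: G], #|edge_cut X| < k &
          exists C1 C2 : {set del_edges (edge_cut X)},
            [/\ C1 \in components (del_edges (edge_cut X)),
                C2 \in components (del_edges (edge_cut X)),
                C1 != C2,
                ~ is_tree (induced_subgraph C1) &
                ~ is_tree (induced_subgraph C2)]].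

Definition walk_edges (G : sgraph) (s : seq G) : {set {set G}} :=
  [set:: [seq [set z.1; z.2] | z <- zip s (behead s)]].

(* H is isomorphic to a subdivision of P: branch embeds the vertices of P, and
   inner u v lists, from branch u to branch v, the subdividing vertices of the
   path replacing the edge uv (so inner v u is the reversed list). *)
Definition iso_to_subdivision (P H : sgraph) : Prop :=
  exists (branch : P -> H) (inner : P -> P -> seq H),
    let subdivided u v := branch u :: rcons (inner u v) (branch v) in
    [/\ injective branch,
        (forall u v, adj u v ->
           [/\ path (@adj H) (branch u) (rcons (inner u v) (branch v)),
               uniq (subdivided u v) &
               inner v u = rev (inner u v)]),
        (forall u v w, adj u v -> branch w \notin inner u v),
        (forall u v u' v', adj u v -> adj u' v' ->
           [set u; v] != [set u'; v'] -> [disjoint inner u v & inner u' v']) &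
        (forall x : H, (exists u, x = branch u) \/
           exists u v, adj u v /\ x \in inner u v) /\
        (forall e, e \in edges H ->
           exists u v, adj u v /\ e \in walk_edges (subdivided u v))].

(* (false, i) are the vertices of the outer pentagon, (true, i) those of the
   inner pentagram, and (false, i) -- (true, i) are the spokes. *)
Definition petersen_adj (x y : bool * 'I_5) : bool :=
  let step d := (x.2 + d == y.2 %[mod 5]) || (y.2 + d == x.2 %[mod 5]) in
  if x.1 == y.1 then step (if x.1 then 2 else 1) else x.2 == y.2.

Lemma petersen_sym : symmetric petersen_adj.
Proof.
move=> [a i] [b j]; rewrite /petersen_adj /= [b == a]eq_sym [j == i]eq_sym.
by case: eqP => [->|//]; rewrite orbC.
Qed.

Lemma petersen_irr : irreflexive petersen_adj.
Proof.
by case=> [a [i lti]]; rewrite /petersen_adj /= eqxx; case: a;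
   do 5 case: i lti => [|i] lti //.
Qed.

Definition petersen : sgraph := SGraph petersen_sym petersen_irr.

(* F is the edge set of an M-copy of the Petersen graph. The two cycles of
   G - M have edge set E(G) \ M and cover all vertices, so the copy is the
   spanning subgraph with edge set F. *)
Definition M_petersen_copy (G : sgraph) (M F : {set {set G}}) : Prop :=
  (exists N : {set {set G}},
     [/\ N \subset M, #|N| = 5 & F = (edges G :\: M) :|: N]) /\
  iso_to_subdivision petersen (spanning_subgraph F).

(* Main.v *)
Require Import Defs.
From mathcomp Require Import all_boot zify.

(** Each edge of the matching M joins the two cycles, because a matching edge
    inside one of them would be a chord.  Take a spoke e, that is, an edge of M,
    and cut both cycles at its ends.  The other spokes then form a permutation:
    each has a position on the first path and a value, its position on the
    second path.

    If this permutation contains the pattern 3142 or its complement 2413, the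
    four spokes of the pattern together with e meet the second cycle in the
    pentagram order 0, 2, 4, 1, 3 (for 2413, after reversing the second cycle),
    so with the two cycles they form a subdivision of the Petersen graph
    ([petersen_of_chains], [pattern_petersen]).

    A permutation of at least two elements without these patterns is a direct
    or a skew sum of two nonempty permutations ([pattern_or_block_sum]); this is
    the fact that separable permutations are those avoiding 2413 and 3142.  The
    two blocks are pairs of matched arcs, and adding e to one of them splits the
    whole graph into two parts, each consisting of an arc of each cycle and the
    spokes between these arcs.  Only four cycle edges join the two parts.  The
    matching is itself a cut separating the two cycles, so there are at least
    five spokes ([long_cycles]); hence e can be added so that both parts contain
    two spokes, and then both contain a cycle, which contradicts cyclic
    5-edge-connectedness ([arcs_not_matched], [block_sum_absurd]).

    So every spoke lies in a copy.  An edge outside M lies in every copy. *)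

Set Implicit Arguments.
Unset Strict Implicit.
Unset Printing Implicit Defensive.

(** * Permutations avoiding 3142 and 2413 *)

(** Reading values upwards or downwards according to a boolean turns 3142 into
    2413 and direct sums into skew sums, so each argument is made only once. *)
Definition ord_lt (s : bool) (m n : nat) : bool := if s then m < n else n < m.

Lemma ord_lt_trans s m n p : ord_lt s m n -> ord_lt s n p -> ord_lt s m p.
Proof. by rewrite /ord_lt; case: s; lia. Qed.

Lemma ord_ltC s m n : ord_lt (~~ s) m n = ord_lt s n m.
Proof. by case: s. Qed.

Lemma ord_lt_asym s m n : ord_lt s m n -> ~~ ord_lt s n m.
Proof. by rewrite /ord_lt; case: s; lia. Qed.

(** Listed by increasing position, the four values form the pattern 3142 when
    [s] is true and 2413 when it is false. *)
Definition crossing_pattern (T : finType) (pos val : T -> nat) (S : {set T}) :=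
  exists s p1 p2 p3 p4,
    [/\ [/\ p1 \in S, p2 \in S, p3 \in S & p4 \in S],
        [/\ pos p1 < pos p2, pos p2 < pos p3 & pos p3 < pos p4] &
        [/\ ord_lt s (val p2) (val p4), ord_lt s (val p4) (val p1) &
            ord_lt s (val p1) (val p3)]].

(** A direct sum when [s] is true, a skew sum when it is false. *)
Definition block_sum (T : finType) (pos val : T -> nat) (S : {set T}) :=
  exists s (A B : {set T}),
    [/\ A :|: B = S, A != set0, B != set0 &
        forall a b, a \in A -> b \in B ->
          pos a < pos b /\ ord_lt s (val a) (val b)].

Lemma crossing_pattern_sub (T : finType) (pos val : T -> nat) (S S' : {set T}) :
  S' \subset S -> crossing_pattern pos val S' -> crossing_pattern pos val S.
Proof.
move=> /subsetP sub [s [p1 [p2 [p3 [p4 [[i1 i2 i3 i4] ? ?]]]]]].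
by exists s, p1, p2, p3, p4; split=> //; split; apply: sub.
Qed.

(** Induction on the size.  Remove the rightmost element x and split the rest
    as A, B, say with A below B.  If x is above A it joins B; if x is below A it
    is below everything and forms a block of its own.  Otherwise x lies strictly
    between values of A, and A with x, which is smaller because B is nonempty,
    splits as C, D with x in D.  If C is below D, then C is below the union of D
    and B.  If C is above D, an element of C, one of A below x, one of B and
    finally x form the pattern. *)
Lemma pattern_or_block_sum (T : finType) (pos val : T -> nat) (S : {set T}) :
  {in S &, injective pos} -> {in S &, injective val} -> 1 < #|S| ->
  crossing_pattern pos val S \/ block_sum pos val S.
Proof.
have [k] := ubnP #|S|; elim: k S => // k IH S ltSk injp injv S2.
have [x0 Sx0] : exists x0, x0 \in S by apply/set0Pn; rewrite -card_gt0; lia.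
pose x := [arg max_(y > x0 in S) pos y].
have [Sx xmax] : x \in S /\ forall y, y \in S -> y != x -> pos y < pos x.
  rewrite /x; case: arg_maxnP => // z Sz zmax; split=> // y Sy yz.
  rewrite ltn_neqAle; apply/andP; split; last exact: zmax.
  apply: contra yz => /eqP e.
  by apply/eqP/injp.
clearbody x.
have IHs (S' : {set T}) : S' \subset S -> #|S'| < #|S| -> 1 < #|S'| ->
    crossing_pattern pos val S \/ block_sum pos val S'.
  move=> sub ltS' S'2; have /subsetP sub' := sub.
  have [||||pat|] := IH S' => //; try by right.
  - lia.
  - by move=> y z /sub' Sy /sub' Sz; apply: injp.
  - by move=> y z /sub' Sy /sub' Sz; apply: injv.
  by left; apply: crossing_pattern_sub pat.
have cardS : #|S| = (#|S :\ x|).+1 by rewrite (cardsD1 x) Sx.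
have cmp s y : y \in S -> y != x ->
    ord_lt s (val y) (val x) = ~~ ord_lt s (val x) (val y).
  move=> Sy yx; have : val y != val x.
    by apply: contra yx => /eqP e; apply/eqP/injv.
  by rewrite /ord_lt; case: s; lia.
have [S'1|S'2] := leqP #|S :\ x| 1.
  have /cards1P [y Ey] : #|S :\ x| == 1 by lia.
  have : y \in S :\ x by rewrite Ey set11.
  rewrite in_setD1 => /andP [yx Sy].
  right; exists (val y < val x), [set y], [set x]; split.
  - by rewrite -Ey setUC setD1K.
  - by apply/set0Pn; exists y; rewrite set11.
  - by apply/set0Pn; exists x; rewrite set11.
  move=> a b /set1P-> /set1P->; split; first exact: xmax.
  have := cmp true y Sy yx; rewrite /ord_lt.
  by case: ifP => // _ /esym/negbFE.
have [||//|pat|] := IHs (S :\ x); rewrite ?subsetDl //; try by left.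
  by rewrite cardS.
case=> s [A [B [EAB A0 B0 AB]]].
have inS' y : (y \in S) && (y != x) = (y \in A) || (y \in B).
  by rewrite -in_setU EAB in_setD1 andbC.
have AS y : y \in A -> y \in S /\ y != x.
  by move=> Ay; apply/andP; rewrite inS' Ay.
have BS y : y \in B -> y \in S /\ y != x.
  by move=> By; apply/andP; rewrite inS' By orbT.
have [a0 Aa0] := set0Pn _ A0; have [b0 Bb0] := set0Pn _ B0.
(* x is above A: it can be added to B. *)
have [/forall_inP Ax|] := boolP [forall a in A, ord_lt s (val a) (val x)].
  right; exists s, A, (x |: B); split=> //.
  - by rewrite setUCA EAB setD1K.
  - by apply/set0Pn; exists x; rewrite setU11.
  move=> a b Aa /setU1P [->|Bb]; last exact: AB.
  by have [Sa ax] := AS a Aa; split; [exact: xmax | exact: Ax].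
case/forall_inPn=> a2 Aa2 a2x.
(* x is below A, hence below B as well: it is a block by itself. *)
have [/forall_inP xA|] := boolP [forall a in A, ord_lt s (val x) (val a)].
  right; exists (~~ s), (S :\ x), [set x]; split=> //.
  - by rewrite setUC setD1K.
  - by rewrite -card_gt0; lia.
  - by apply/set0Pn; exists x; rewrite set11.
  move=> a b S'a /set1P->; move: (S'a); rewrite in_setD1 => /andP [ax Sa].
  split; first exact: xmax.
  move: S'a; rewrite -EAB in_setU => /orP [/xA|Ba]; first by case: (s).
  move: (xA _ Aa0) (AB _ _ Aa0 Ba) => h [_].
  by rewrite ord_ltC; apply: ord_lt_trans.
case/forall_inPn=> a1 Aa1 xa1.
have [Sa1 a1x] := AS _ Aa1; rewrite -cmp // in xa1.
have xNA : x \notin A by apply/negP => /AS [_]; rewrite eqxx.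
(* x is caught between values of A: split A with x added. *)
have [||||] := IHs (x |: A); try by left.
- apply/subsetP => y /setU1P [->//|/AS [] //].
- apply: proper_card; apply/properP; split.
    by apply/subsetP => y /setU1P [->//|/AS [] //].
  exists b0; first by case: (BS _ Bb0).
  apply/negP => /setU1P [e|Ab0].
    by case: (BS _ Bb0) => _; rewrite e eqxx.
  by case: (AB _ _ Ab0 Bb0); rewrite ltnn.
- by rewrite cardsU1 xNA /= add1n ltnS card_gt0.
case=> s' [C [D [ECD C0 D0 CD]]].
have [c Cc] := set0Pn _ C0.
have inA y : (y \in C) || (y \in D) = (y == x) || (y \in A).
  by rewrite -in_setU ECD in_setU1.
have xNC : x \notin C.
  apply/negP => Cx; have [d Dd] := set0Pn _ D0.
  have [xd _] := CD _ _ Cx Dd.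
  have := inA d; rewrite Dd orbT; case: eqP => [e|/eqP dx] /=.
    by move: xd; rewrite e ltnn.
  by move=> /esym/AS [Sd _]; move: (ltn_trans xd (xmax _ Sd dx)); rewrite ltnn.
have Dx : x \in D by have := inA x; rewrite (negbTE xNC) eqxx.
have CA y : y \in C -> y \in A.
  move=> Cy; have := inA y; rewrite Cy /=; case: eqP => // e.
  by move: xNC; rewrite -e Cy.
have [ss|ss] := eqVneq s' s.
  right; exists s, C, (D :|: B); split=> //.
  - by rewrite setUA ECD -setUA EAB setD1K.
  - by apply/set0Pn; exists x; rewrite in_setU Dx.
  move=> a b Ca /setUP [Db|Bb]; last by apply: AB => //; apply: CA.
  by rewrite -ss; apply: CD.
have {ss}Es : s' = ~~ s by case: (s') (s) ss => [] [].
have [cx vcx] := CD _ _ Cc Dx.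
have Da1 : a1 \in D.
  have := inA a1; rewrite Aa1 orbT => /orP [Ca1|//].
  have [_] := CD _ _ Ca1 Dx.
  by rewrite Es ord_ltC => /ord_lt_asym; rewrite xa1.
have [ca1 _] := CD _ _ Cc Da1.
have [a1b0 _] := AB _ _ Aa1 Bb0; have [cb0 vcb0] := AB _ _ (CA _ Cc) Bb0.
have [Sb0 b0x] := BS _ Bb0; have [Sc _] := AS _ (CA _ Cc).
left; exists s, c, a1, b0, x; split; split=> //; first exact: xmax.
by move: vcx; rewrite Es ord_ltC.
Qed.

(** * Edges of walks and cycles *)

Lemma adj_neq (G : sgraph) (x y : G) : adj x y -> x != y.
Proof. by apply: contraTneq => ->; rewrite adj_irr. Qed.

Lemma set2_eq (T : finType) (a b x y : T) :
  [set a; b] = [set x; y] -> (a = x /\ b = y) \/ (a = y /\ b = x).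
Proof.
move=> E; have : (a \in [set x; y]) && (b \in [set x; y]).
  by rewrite -E set21 set22.
have : (x \in [set a; b]) && (y \in [set a; b]) by rewrite E set21 set22.
rewrite !in_set2 => /andP [] /orP [] /eqP -> /orP [] /eqP -> /andP [];
  rewrite ?eqxx ?orbb => /eqP h1 /eqP h2; subst; auto.
Qed.

Lemma adj_edge (G : sgraph) (x y : G) : adj x y -> [set x; y] \in edges G.
Proof. by move=> xy; apply/imsetP; exists (x, y); rewrite ?inE. Qed.

Lemma edgeP (G : sgraph) (e : {set G}) :
  reflect (exists x y, adj x y /\ e = [set x; y]) (e \in edges G).
Proof.
apply: (iffP imsetP) => [[[x y] /=]|[x [y [xy ->]]]].
  by rewrite inE /= => xy ->; exists x, y.
by exists (x, y); rewrite ?inE.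
Qed.

Lemma edge_adj (G : sgraph) (x y : G) : [set x; y] \in edges G -> adj x y.
Proof.
by case/edgeP=> a [b [ab /set2_eq [[-> ->]|[-> ->]]]] //; rewrite adj_sym.
Qed.

Lemma walk_edges_cons (G : sgraph) (x y : G) s :
  walk_edges (x :: y :: s) = [set x; y] |: walk_edges (y :: s).
Proof. by apply/setP => e; rewrite !inE. Qed.

Lemma walk_edges1 (G : sgraph) (x : G) : walk_edges [:: x] = set0.
Proof. by apply/setP => e; rewrite !inE. Qed.

Lemma walk_edges_cat (G : sgraph) (x y : G) s t :
  walk_edges (x :: s ++ y :: t) =
  walk_edges (x :: rcons s y) :|: walk_edges (y :: t).
Proof.
elim: s x => [|z s IH] x /=; last by rewrite !walk_edges_cons IH setUA.
by rewrite !walk_edges_cons walk_edges1 setU0.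
Qed.

Lemma walk_edges_rcons (G : sgraph) (x y : G) s :
  walk_edges (x :: rcons s y) = walk_edges (x :: s) :|: [set [set last x s; y]].
Proof.
elim: s x => [|z s IH] x /=; last by rewrite !walk_edges_cons IH setUA.
by rewrite walk_edges_cons !walk_edges1 setUC.
Qed.

Lemma walk_edges_sub (G : sgraph) (s : seq G) e x :
  e \in walk_edges s -> x \in e -> x \in s.
Proof.
case: s => [|a s]; first by rewrite inE.
elim: s a => [|b s IH] a; first by rewrite inE.
rewrite walk_edges_cons => /setU1P [->|/IH {}IH].
  by rewrite !inE => /orP [] ->; rewrite ?orbT.
by move=> /IH; rewrite [in X in _ -> X]inE => ->; rewrite orbT.
Qed.


Lemma cycle_edges_walk (G : sgraph) (x : G) s :
  cycle_edges (x :: s) \subset walk_edges (x :: rcons s x).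
Proof.
apply/subsetP => e /imsetP [y yin ->]; rewrite /next.
suff H z : [set y; next_at y z x s] \in walk_edges (x :: rcons s z) by apply: H.
elim: s x yin => [|a s IH] x /=; rewrite in_cons.
  by rewrite orbF walk_edges_cons => /eqP ->; rewrite eqxx setU11.
rewrite walk_edges_cons in_setU1.
by case: (eqVneq y x) => [->|_] /=; rewrite ?eqxx // => /IH ->; rewrite orbT.
Qed.

(** [c'] traverses the cycle [c] from another starting point or in the other
    direction. *)
Definition same_cycle (G : sgraph) (c c' : seq G) :=
  [/\ is_cycle c', c' =i c & cycle_edges c' = cycle_edges c].

Lemma same_cycle_rot (G : sgraph) n (c : seq G) :
  is_cycle c -> same_cycle c (rot n c).
Proof.
move=> /and3P [c3 cc cu]; split.
- by rewrite /is_cycle size_rot rot_cycle rot_uniq c3 cc.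
- by move=> x; rewrite mem_rot.
- apply/setP => e; apply/imsetP/imsetP => -[x xc ->]; exists x;
  by rewrite ?next_rot ?mem_rot // -(mem_rot n).
Qed.

Lemma same_cycle_rev (G : sgraph) (c : seq G) :
  is_cycle c -> same_cycle c (rev c).
Proof.
move=> /and3P [c3 cc cu]; split.
- rewrite /is_cycle size_rev rev_cycle rev_uniq c3 cu andbT /=.
  by rewrite (eq_cycle (e' := @adj G)) // => x y; rewrite adj_sym.
- by move=> x; rewrite mem_rev.
- apply/setP => e; apply/imsetP/imsetP => -[x xc ->].
    exists (prev c x); first by rewrite mem_prev -mem_rev.
    by rewrite next_rev // next_prev // setUC.
  exists (next c x); first by rewrite mem_rev mem_next.
  by rewrite next_rev // prev_next // setUC.
Qed.

Definition two_cycles (G : sgraph) (M : {set {set G}}) (c1 c2 : seq G) :=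
  [/\ is_cycle c1 /\ is_cycle c2,
      [disjoint c1 & c2],
      (forall x : G, (x \in c1) || (x \in c2)),
      edges G :\: M = cycle_edges c1 :|: cycle_edges c2 &
      chordless c1 /\ chordless c2].

Lemma two_cycles_sym (G : sgraph) (M : {set {set G}}) c1 c2 :
  two_cycles M c1 c2 -> two_cycles M c2 c1.
Proof.
case=> -[? ?] ? cov E [? ?]; split=> //.
- by rewrite disjoint_sym.
- by move=> x; rewrite orbC.
- by rewrite setUC.
Qed.

Lemma two_cycles_same (G : sgraph) (M : {set {set G}}) c1 c2 c2' :
  same_cycle c2 c2' -> two_cycles M c1 c2 -> two_cycles M c1 c2'.
Proof.
case=> cy mem Ed [[? ?] dis cov E [? ch]]; split=> //.
- by rewrite disjoint_sym (eq_disjoint mem) disjoint_sym.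
- by move=> x; rewrite mem.
- by rewrite Ed.
- by split=> // x y; rewrite Ed !mem; apply: ch.
Qed.

(** * The matching *)

Definition mate (G : sgraph) (M : {set {set G}}) (x : G) : G :=
  odflt x [pick y | [set x; y] \in M].

Lemma mate_edge (G : sgraph) (M : {set {set G}}) x :
  perfect_matching M -> [set x; mate M x] \in M.
Proof.
case=> /subsetP ME /(_ x) /eqP/cards1P [e Ee].
have : e \in [set e in M | x \in e] by rewrite Ee set11.
rewrite inE => /andP [eM xe]; rewrite /mate.
case: pickP => //= no.
have /edgeP [a [b [_ Eab]]] := ME _ eM.
move: xe eM; rewrite {e Ee}Eab in_set2 => /orP [] /eqP <-.
  by move=> eM; have := no b; rewrite eM.
by rewrite setUC => eM; have := no a; rewrite eM.
Qed.

Lemma mate_uniq (G : sgraph) (M : {set {set G}}) x y :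
  perfect_matching M -> [set x; y] \in M -> y = mate M x.
Proof.
move=> pm xyM; have mM := mate_edge x pm.
case: pm => _ /(_ x) /eqP/cards1P [e Ee].
have : [set x; y] \in [set e in M | x \in e] by rewrite inE xyM set21.
have : [set x; mate M x] \in [set e in M | x \in e] by rewrite inE mM set21.
rewrite Ee => /set1P <- /set1P /set2_eq [[_ ->]|[<- ->]] //.
Qed.

Lemma mateK (G : sgraph) (M : {set {set G}}) :
  perfect_matching M -> involutive (mate M).
Proof.
by move=> pm x; apply/esym/(mate_uniq pm); rewrite setUC; apply: mate_edge.
Qed.

Lemma mate_adj (G : sgraph) (M : {set {set G}}) x :
  perfect_matching M -> adj x (mate M x).
Proof.
move=> pm; apply: edge_adj; have := mate_edge x pm.
by case: pm => /subsetP ME _ /ME.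
Qed.

(** A matching edge inside a cycle would be a chord of it: cycle edges are not
    in the matching. *)
Lemma mate_crosses (G : sgraph) (M : {set {set G}}) c1 c2 x :
  perfect_matching M -> two_cycles M c1 c2 -> x \in c1 -> mate M x \in c2.
Proof.
move=> pm [_ _ cov E [ch _]] xc; case/orP: (cov (mate M x)) => // mc.
have : [set x; mate M x] \in edges G :\: M.
  by rewrite E in_setU ch // mate_adj.
by rewrite in_setD mate_edge.
Qed.

Lemma edge_cases (G : sgraph) (M : {set {set G}}) c1 c2 e :
  perfect_matching M -> two_cycles M c1 c2 -> e \in edges G ->
  [\/ exists2 x, x \in c1 & e = [set x; mate M x],
      e \in cycle_edges c1 | e \in cycle_edges c2].
Proof.
move=> pm tc eE; have [eM|eM] := boolP (e \in M); last first.
  have : e \in edges G :\: M by rewrite in_setD eM.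
  case: tc => _ _ _ -> _ /setUP [] h; first by constructor 2.
  by constructor 3.
constructor 1; have /edgeP [a [b [_ Ee]]] := eE.
rewrite {e eE}Ee in eM *; have Eb := mate_uniq pm eM.
have [_ _ cov _ _] := tc; case/orP: (cov a) => ac.
  by exists a => //; rewrite -Eb.
exists b; first by rewrite Eb; apply: mate_crosses (two_cycles_sym tc) ac.
by rewrite Eb mateK // setUC.
Qed.

(** * Cuts separating two cycles *)

(** A cycle stays inside its component, so it lifts to a cycle of the induced
    subgraph. *)
Lemma cycle_component_not_tree (H : sgraph) (c : seq H) x :
  is_cycle c -> x \in c ->
  ~ is_tree (induced_subgraph [set y in [set: H] | connect (@adj H) x y]).
Proof.
move=> cyc xc [_ acyclic]; set C := [set y in _ | _] in acyclic.
have [c3 cc cu] := and3P cyc.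
have inC y : y \in c -> y \in C.
  move=> yc; rewrite !inE /=.
  have [i t Et] := rot_to xc.
  have: path (@adj H) x (rcons t x) by move: cc; rewrite -(rot_cycle i) Et.
  rewrite rcons_path => /andP [pt _]; apply: (path_connect pt).
  by rewrite -Et mem_rot.
pose c' : seq (induced_subgraph C) := pmap insub c.
have Ec : map val c' = c.
  rewrite /c' (pmap_filter (@insubK _ _ _)); apply/all_filterP/allP => y /inC yC.
  by rewrite /= insubT.
apply: (negP (acyclic c')); rewrite /is_cycle.
rewrite -(size_map val) -(map_inj_uniq val_inj) Ec c3 cu andbT /=.
by rewrite -Ec cycle_map in cc.
Qed.

(** Deleting the cut removes no edge of either cycle and leaves the two sides
    disconnected, so each cycle survives in a component of its own. *)
Lemma cycles_across_cut (G : sgraph) k (X : {set G}) (c c' : seq G) :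
  cyclically_edge_connected k G -> is_cycle c -> is_cycle c' ->
  {in c, forall x, x \in X} -> {in c', forall x, x \notin X} ->
  k <= #|edge_cut X|.
Proof.
move=> conn cyc cyc' cX c'X; rewrite leqNgt; apply/negP => ltk; apply: conn.
have [x xc] : exists x, x \in c.
  by case: c cyc {cX} => // x c _; exists x; rewrite mem_head.
have [x' xc'] : exists x, x \in c'.
  by case: c' cyc' {c'X} => // x' c' _; exists x'; rewrite mem_head.
pose H := del_edges (edge_cut X).
have adjH (a b : G) : @adj H a b = adj a b && ((a \in X) == (b \in X)).
  rewrite /H /=; case ab: (adj a b) => //=.
  rewrite in_setD adj_edge // andbT inE adj_edge //=.
  have -> : ([set a; b] :&: X != set0) = (a \in X) || (b \in X).
    apply/set0Pn/orP => [[y]|[h|h]]; last 2 first.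
    - by exists a; rewrite !inE eqxx h.
    - by exists b; rewrite !inE eqxx h orbT.
    by rewrite !inE => /andP [/orP [] /eqP -> ->]; auto.
  have -> : ([set a; b] :\: X != set0) = (a \notin X) || (b \notin X).
    apply/set0Pn/orP => [[y]|[h|h]]; last 2 first.
    - by exists a; rewrite !inE eqxx h.
    - by exists b; rewrite !inE eqxx h orbT.
    by rewrite !inE => /andP [h /orP [] /eqP <-]; auto.
  by do 2 case: (_ \in X).
have cycH (s : seq G) : is_cycle s ->
    {in s &, forall a b, (a \in X) = (b \in X)} -> is_cycle (s : seq H).
  move=> /and3P [s3 sc su] sX; apply/and3P; split=> //.
  apply: (sub_in_cycle (P := [in s]) _ _ sc); last exact/allP.
  by move=> a b sa sb ab; rewrite adjH ab (sX a b) ?eqxx.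
have cH : is_cycle (c : seq H) by apply: cycH => // a b /cX -> /cX ->.
have cH' : is_cycle (c' : seq H).
  by apply: cycH => // a b /c'X /negbTE -> /c'X /negbTE ->.
exists X; split=> //.
- by apply/set0Pn; exists x; apply: cX.
- by apply: contraNneq (c'X _ xc') => ->.
exists [set y in [set: H] | connect (@adj H) x y].
exists [set y in [set: H] | connect (@adj H) x' y]; split.
- by apply/imsetP; exists x.
- by apply/imsetP; exists x'.
- apply/eqP => /setP /(_ (x' : H)); rewrite !inE /= connect0.
  have clX : closed (@adj H) (mem X).
    by move=> a b; rewrite adjH => /andP [_ /eqP].
  move=> con; have := @closed_connect H (@adj H) (mem X) clX x x' con.
  by rewrite /= cX // (negbTE (c'X _ xc')).
- exact: cycle_component_not_tree cH xc.
- exact: cycle_component_not_tree cH' xc'.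
Qed.

(** * Matched arcs give small cuts *)

Lemma ladder_cycle (G : sgraph) (x x' y y' : G) l :
  adj x x' -> adj x y -> adj x' y' ->
  path (@adj G) y (rcons l y') -> uniq (y :: rcons l y') ->
  x \notin y :: rcons l y' -> x' \notin y :: rcons l y' ->
  is_cycle (x' :: x :: y :: rcons l y').
Proof.
move=> xx' xy x'y' pth U xN x'N; apply/and3P; split=> //.
  rewrite /= rcons_path last_rcons [adj x' x]adj_sym xx' xy /= pth.
  by rewrite adj_sym.
rewrite cons_uniq in_cons negb_or x'N cons_uniq xN U !andbT.
by rewrite eq_sym adj_neq.
Qed.

(** The first two vertices of [p] are adjacent; their spokes and the segment of
    [p'] between the mates close up to a cycle. *)
Lemma arcs_contain_cycle (G : sgraph) (M : {set {set G}}) (p p' : seq G) :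
  perfect_matching M -> sorted (@adj G) p -> sorted (@adj G) p' ->
  uniq p' -> {in p, forall x, x \notin p'} -> 1 < size p ->
  {in p, forall x, mate M x \in p'} ->
  exists2 c, is_cycle c & {subset c <= p ++ p'}.
Proof.
move=> pm; case: p => [|x [|x' p]] //= /andP [xx' _] sp' U dis _ mp.
have xp : x \in x :: x' :: p by rewrite mem_head.
have x'p : x' \in x :: x' :: p by rewrite !inE eqxx orbT.
move: (mp _ xp) (mp _ x'p) (dis _ xp) (dis _ x'p).
have xy := mate_adj x pm; have x'y' := mate_adj x' pm.
have yy' : mate M x != mate M x'.
  by rewrite (inj_eq (inv_inj (mateK pm))) adj_neq.
move: (mate M x) (mate M x') xy x'y' yy' => y y' xy x'y' yy' yp' y'p' xN x'N.
set q := x :: x' :: p in xp x'p dis mp *.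
(* The mates of the two vertices may come in either order along [p']. *)
have main a a' b b' r l r' : a \in q -> a' \in q ->
    adj a a' -> adj a b -> adj a' b' ->
    p' = r ++ b :: l ++ b' :: r' -> a \notin p' -> a' \notin p' ->
    exists2 c, is_cycle c & {subset c <= q ++ p'}.
  move=> aq a'q aa' ab a'b' Ep' aN a'N.
  have E : p' = r ++ (b :: rcons l b') ++ r' by rewrite Ep' /= cat_rcons.
  have sub z : z \in b :: rcons l b' -> z \in p'.
    by move=> zb; rewrite E !mem_cat zb orbT.
  exists (a' :: a :: b :: rcons l b'); last first.
    move=> z; rewrite mem_cat 2!in_cons.
    by case/or3P=> [/eqP->|/eqP->|/sub ->]; rewrite ?aq ?a'q ?orbT.
  have {}aN := contra (sub a) aN; have {}a'N := contra (sub a') a'N.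
  move: sp' U; rewrite E => sp' U.
  move: U; rewrite !cat_uniq => /and3P [_ _ /andP [U _]].
  apply: ladder_cycle => //.
  case: r {Ep' E} sp' => [|r0 r] /=; rewrite ?cat_path /=.
    by case/andP.
  by case/and3P => _ _; rewrite cat_path => /andP [].
have [r1 [t Ep']] : exists r1 t, p' = r1 ++ y :: t.
  by case/splitPr: (yp') => r1 t; exists r1, t.
move: (y'p'); rewrite {1}Ep' mem_cat in_cons eq_sym (negbTE yy') /=.
case/orP=> [y'r|y't].
  case/splitPr: y'r Ep' => l r' Ep'.
  by apply: (main x' x y' y l r' t) => //; rewrite 1?adj_sym // Ep' -catA.
case/splitPr: y't Ep' => l r' Ep'.
exact: (main x x' y y' r1 l r').
Qed.

Lemma sorted_cat_adj (G : sgraph) (p q : seq G) :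
  cycle (@adj G) (p ++ q) -> sorted (@adj G) p /\ sorted (@adj G) q.
Proof.
case: p => [|x p] /=.
  by case: q => //= y q; rewrite rcons_path => /andP [].
rewrite rcons_path cat_path => /andP [/andP [-> pq] _]; split=> //.
by case: q pq => //= y q /andP [].
Qed.

Lemma edge_cut_walk (G : sgraph) (X : {set G}) s e :
  e \in edge_cut X -> e \in walk_edges s ->
  ~ {in s &, forall x y, (x \in X) = (y \in X)}.
Proof.
rewrite inE => /and3P [_ /set0Pn [x] /setIP [xe xX] /set0Pn [y]].
move=> /setDP [ye yX] es sX.
by move: yX; rewrite -(sX x y) ?xX // (walk_edges_sub es).
Qed.

(** Going once around the cycle, one leaves [p] once and enters it once. *)
Lemma cut_two_arcs (G : sgraph) (X : {set G}) (p q : seq G) :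
  0 < size p -> 0 < size q ->
  {in p, forall x, x \in X} -> {in q, forall x, x \notin X} ->
  exists e1 e2, edge_cut X :&: cycle_edges (p ++ q) \subset [set e1; e2].
Proof.
case: p q => [|h p] // [|k q] // _ _ pX qX.
exists [set last h p; k], [set last k q; h].
apply/subsetP => e /setIP [eX].
move/(subsetP (cycle_edges_walk _ _)); rewrite rcons_cat rcons_cons walk_edges_cat.
rewrite !walk_edges_rcons !in_setU !in_set1 => /orP [] /orP [].
- move/(edge_cut_walk eX) => []; move=> x y /pX -> /pX -> //.
- by move=> ->.
- move/(edge_cut_walk eX) => []; move=> x y /qX/negbTE -> /qX/negbTE -> //.
- by move=> ->; rewrite orbT.
Qed.

(** Separate [p] and [p'] from [q] and [q']: no spoke is cut, each cycle is cut
    in two edges, and both sides contain a cycle. *)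
Lemma arcs_not_matched (G : sgraph) (M : {set {set G}}) (p q p' q' : seq G) :
  perfect_matching M -> cyclically_edge_connected 5 G ->
  two_cycles M (p ++ q) (p' ++ q') -> 1 < size p -> 1 < size q ->
  {in p, forall x, mate M x \in p'} -> {in q, forall x, mate M x \in q'} ->
  False.
Proof.
move=> pm conn tc p2 q2 pp' qq'.
have [[cy cy'] dis cov _ _] := tc.
have /and3P [_ cc cu] := cy; have /and3P [_ cc' cu'] := cy'.
have [sp sq] := sorted_cat_adj cc; have [sp' sq'] := sorted_cat_adj cc'.
have dis' x : x \in p ++ q -> x \notin p' ++ q'.
  by move=> h; rewrite (disjointFr dis h).
move: (cu) (cu'); rewrite !cat_uniq => /and3P [_ pq _] /and3P [up' pq' uq'].
pose X := [set x in p ++ p'].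
have pX : {in p, forall x, x \in X} by move=> x xp; rewrite inE mem_cat xp.
have p'X : {in p', forall x, x \in X}.
  by move=> x xp; rewrite inE mem_cat xp orbT.
have qX : {in q, forall x, x \notin X}.
  move=> x xq; rewrite inE mem_cat negb_or (hasPn pq) //=.
  have := dis' x; rewrite !mem_cat xq orbT => /(_ isT).
  by rewrite negb_or => /andP [].
have q'X : {in q', forall x, x \notin X}.
  move=> x xq'; rewrite inE mem_cat negb_or (hasPn pq') // andbT.
  by apply/negP => xp; have := dis' x; rewrite !mem_cat xp xq' orbT => /(_ isT).
have [c cyc cX] : exists2 c, is_cycle c & {subset c <= p ++ p'}.
  apply: arcs_contain_cycle pp' => // x xp; have := dis' x.
  by rewrite !mem_cat xp negb_or => /(_ isT) /andP [].
have [d cyd dX] : exists2 d, is_cycle d & {subset d <= q ++ q'}.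
  apply: arcs_contain_cycle qq' => // x xp; have := dis' x.
  by rewrite !mem_cat xp orbT negb_or => /(_ isT) /andP [].
have : 5 <= #|edge_cut X|.
  apply: (cycles_across_cut conn cyc cyd) => x.
    by move=> /cX; rewrite mem_cat => /orP [/pX|/p'X].
  by move=> /dX; rewrite mem_cat => /orP [/qX|/q'X].
have nz (s s' : seq G) : 1 < size s -> {in s, forall x, mate M x \in s'} ->
    0 < size s'.
  case: s => // x s _ h; have := h x (mem_head _ _).
  by case: s' {h}.
have [] := cut_two_arcs _ _ pX qX; try exact: ltnW.
move=> e1 [e2 /subsetP sub12].
have [] := cut_two_arcs _ _ p'X q'X; try by [exact: nz pp' | exact: nz qq'].
move=> e3 [e4 /subsetP sub34].
have sub : edge_cut X \subset [:: e1; e2; e3; e4].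
  apply/subsetP => e eX.
  have eE : e \in edges G by move: eX; rewrite inE => /andP [].
  have [[x xc Ee]|ec|ec] := edge_cases pm tc eE.
  - case: (@edge_cut_walk _ _ [:: x; mate M x] e eX).
      by rewrite walk_edges_cons walk_edges1 Ee setU0 set11.
    have : (x \in X) = (mate M x \in X).
      move: xc; rewrite mem_cat => /orP [h|h].
        by rewrite (pX _ h) (p'X _ (pp' _ h)).
      by rewrite (negbTE (qX _ h)) (negbTE (q'X _ (qq' _ h))).
    move=> E a b; rewrite !in_cons !in_nil !orbF.
    by case/orP=> /eqP -> /orP [] /eqP ->; rewrite -?E.
  - have := sub12 e; rewrite in_setI eX ec !inE => /(_ isT) /orP [] ->;
    by rewrite ?orbT.
  - have := sub34 e; rewrite in_setI eX ec !inE => /(_ isT) /orP [] ->;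
    by rewrite ?orbT.
move/leq_trans => /(_ _ (subset_leq_card sub)) /leq_trans /(_ (card_size _)).
by [].
Qed.

(** The spokes form a cut separating the two cycles. *)
Lemma long_cycles (G : sgraph) (M : {set {set G}}) c1 c2 :
  perfect_matching M -> cyclically_edge_connected 5 G ->
  two_cycles M c1 c2 -> 4 < size c1.
Proof.
move=> pm conn tc; have [[cy cy'] dis cov _ _] := tc.
pose X := [set x in c1].
have : 5 <= #|edge_cut X|.
  apply: (cycles_across_cut conn cy cy') => x; rewrite inE //.
  by move=> xc; rewrite (disjointFl dis xc).
move/leq_trans; apply; apply: leq_trans (card_size c1).
apply: leq_trans (leq_imset_card (fun x => [set x; mate M x]) (mem c1)).
apply/subset_leq_card/subsetP => e eX.
have eE : e \in edges G by move: eX; rewrite inE => /andP [].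
have [[x xc Ee]|ec|ec] := edge_cases pm tc eE.
- by apply/imsetP; exists x.
- have [x [s Ec]] : exists x s, c1 = x :: s.
    by case: (c1) cy => // x s _; exists x, s.
  move: ec; rewrite Ec => /(subsetP (cycle_edges_walk _ _)).
  move=> /(edge_cut_walk eX) [] a b.
  by rewrite -rcons_cons !mem_rcons !inE -!in_cons Ec !in_cons !orbA !orbb => -> ->.
- have [x [s Ec]] : exists x s, c2 = x :: s.
    by case: (c2) cy' => // x s _; exists x, s.
  move: ec; rewrite Ec => /(subsetP (cycle_edges_walk _ _)).
  move=> /(edge_cut_walk eX) [] a b.
  have h z : z \in x :: rcons s x -> (z \in X) = false.
    rewrite -rcons_cons mem_rcons in_cons => zc; rewrite inE.
    rewrite (disjointFl dis) // Ec.
    by case/predU1P: zc => [->|//]; rewrite mem_head.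
  by move=> /h -> /h ->.
Qed.

(** * Subdivisions of the Petersen graph *)

(** The orientation of the outer pentagon and of the inner pentagram; every edge
    of the Petersen graph other than a spoke joins [u] to [rim_next u] for
    exactly one [u]. *)
Definition rim_next (u : bool * 'I_5) : bool * 'I_5 :=
  (u.1, Ordinal (ltn_pmod (u.2 + (if u.1 then 2 else 1)) (isT : 0 < 5))).

Lemma petersen_adjE (u v : bool * 'I_5) :
  petersen_adj u v =
  [|| rim_next u == v, rim_next v == u | (u.1 != v.1) && (u.2 == v.2)].
Proof.
case: u v => [a [i lti]] [b [j ltj]].
rewrite /petersen_adj /rim_next !xpair_eqE -!val_eqE /=.
by case: a b => [] []; case: i lti => [|[|[|[|[|i]]]]] lti //;
   case: j ltj => [|[|[|[|[|j]]]]] ltj //.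
Qed.

Lemma rim_next_asym u : (rim_next (rim_next u) == u) = false.
Proof.
case: u => [a [i lti]]; rewrite /rim_next !xpair_eqE -!val_eqE /=.
by case: a; case: i lti => [|[|[|[|[|i]]]]] lti //.
Qed.

Lemma rim_next_neq u : (rim_next u == u) = false.
Proof. by apply/eqP => E; have := rim_next_asym u; rewrite !E eqxx. Qed.

(** A recipe for subdivisions of the Petersen graph: cut the two rims into ten
    disjoint blocks, each a branch vertex [B u] followed by the inner vertices
    [L u] of the path to the next branch vertex.  Disjointness of the blocks
    gives all the disjointness and injectivity conditions at once. *)
Lemma petersen_subdivision (H : sgraph) (B : petersen -> H)
    (L : petersen -> seq H) :
  (forall u, path (@adj H) (B u) (rcons (L u) (B (rim_next u)))) ->
  (forall i, adj (B (false, i)) (B (true, i))) ->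
  (forall u, uniq (B u :: L u)) ->
  (forall u v x, x \in B u :: L u -> x \in B v :: L v -> u = v) ->
  (forall x, exists u, x \in B u :: L u) ->
  (forall e, e \in edges H ->
     (exists u, e \in walk_edges (B u :: rcons (L u) (B (rim_next u)))) \/
     exists i, e = [set B (false, i); B (true, i)]) ->
  iso_to_subdivision petersen H.
Proof.
move=> pathB spoke uniqB disB covB edgeB.
pose inner u v := if rim_next u == v then L u else
                  if rim_next v == u then rev (L v) else [::].
have innerF u : inner u (rim_next u) = L u by rewrite /inner eqxx.
have innerB u : inner (rim_next u) u = rev (L u).
  by rewrite /inner rim_next_asym eqxx.
have memI u v x : x \in inner u v ->
    exists2 w, x \in L w & [set u; v] = [set w; rim_next w].
  rewrite /inner; case: eqP => [<-|_]; first by exists u.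
  case: eqP => [<-|//]; rewrite mem_rev => xL.
  by exists v; rewrite // setUC.
have BNL u w : B w \notin L u.
  apply/negP => h; have E : w = u.
    by apply: (disB _ _ (B w)); rewrite ?mem_head // in_cons h orbT.
  by have /= := uniqB u; rewrite -E in h *; rewrite h.
have injB : injective B.
  by move=> u v E; apply: (disB _ _ (B u)); rewrite ?E mem_head.
(* Rim edges in both directions, then spokes in both directions. *)
have caseP (P : petersen -> petersen -> Prop) :
    (forall u, P u (rim_next u)) -> (forall u, P (rim_next u) u) ->
    (forall i, P (false, i) (true, i)) -> (forall i, P (true, i) (false, i)) ->
    forall u v, adj u v -> P u v.
  move=> P1 P2 P3 P4 [a i] [b j]; rewrite /= petersen_adjE.
  case/or3P=> [/eqP <- //|/eqP <- //|/= /andP [ab /eqP <-]].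
  by case: a b ab => [] [].
have spokeI a i : inner (a, i) (~~ a, i) = [::].
  by rewrite /inner /rim_next !xpair_eqE /=; case: a.
have uniqF u : uniq (B u :: rcons (L u) (B (rim_next u))).
  rewrite -rcons_cons rcons_uniq uniqB andbT in_cons negb_or BNL andbT.
  by apply/eqP => /injB/eqP; rewrite rim_next_neq.
exists B, inner; split=> //.
- apply: caseP => [u|u|i|i]; rewrite ?innerF ?innerB ?(spokeI true)
    ?(spokeI false) ?revK //.
  + split=> //; first last.
      by rewrite -rev_uniq rev_cons rev_rcons revK rcons_cons uniqF.
    have := pathB u; rewrite -rev_path last_rcons belast_rcons rev_cons.
    by rewrite (eq_path (e' := @adj H)) // => x y; rewrite adj_sym.
  + split=> //=; first by rewrite spoke.
    by rewrite inE andbT adj_neq ?spoke.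
  + split=> //=; first by rewrite adj_sym spoke.
    by rewrite inE andbT eq_sym adj_neq ?spoke.
- by move=> u v w _; apply/negP => /memI [t h _]; move: h; apply/negP.
- move=> u v u' v' _ _ neq; rewrite disjoint_has; apply/hasPn => x xI.
  apply/negP => /memI [w' xw' E']; have [w xw E] := memI _ _ _ xI.
  move: neq; rewrite E E' (disB w w' x) ?eqxx // in_cons ?xw ?xw' orbT //.
- split=> [x|e].
    have [u] := covB x; rewrite in_cons => /orP [/eqP ->|xL].
      by left; exists u.
    right; exists u, (rim_next u); rewrite innerF xL.
    by rewrite /= petersen_adjE eqxx.
  case/edgeB=> [[u eu]|[i ->]].
    exists u, (rim_next u); rewrite innerF eu.
    by rewrite /= petersen_adjE eqxx.
  exists (false, i), (true, i); rewrite (spokeI false) /=.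
  by rewrite petersen_adjE /= eqxx ?orbT walk_edges_cons setU11.
Qed.

(** A cycle cut into five arcs, each starting at one of the vertices [z j]. *)
Definition chain (T : Type) (z : nat -> T) (k : nat -> seq T) : seq T :=
  flatten [seq z j :: k j | j <- iota 0 5].

Lemma chainE (T : Type) (z : nat -> T) (k : nat -> seq T) :
  chain z k = z 0 :: k 0 ++ z 1 :: k 1 ++ z 2 :: k 2 ++ z 3 :: k 3 ++
              z 4 :: k 4.
Proof. by rewrite /chain /= cats0. Qed.

Lemma chain_path (T : Type) (e : rel T) z k j :
  cycle e (chain z k) -> j < 5 -> path e (z j) (rcons (k j) (z (j.+1 %% 5))).
Proof.
have pc x s y t : path e x (s ++ y :: t) = path e x (rcons s y) && path e y t.
  by rewrite -cat_rcons cat_path last_rcons.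
rewrite chainE /= !(rcons_cat, rcons_cons) !pc => /and5P [? ? ? ? ?].
by case: j => [|[|[|[|[|j]]]]].
Qed.

Lemma chain_walk (G : sgraph) (z : nat -> G) k e :
  e \in cycle_edges (chain z k) ->
  exists2 j, j < 5 & e \in walk_edges (z j :: rcons (k j) (z (j.+1 %% 5))).
Proof.
rewrite chainE => /(subsetP (cycle_edges_walk _ _)).
rewrite !(rcons_cat, rcons_cons, walk_edges_cat) !in_setU.
case/or4P=> [?|?|?|/orP [?|?]];
  [exists 0|exists 1|exists 2|exists 3|exists 4] => //.
Qed.

Lemma mem_chain (T : eqType) (z : nat -> T) k x :
  (x \in chain z k) = has (fun j => x \in z j :: k j) (iota 0 5).
Proof.
by rewrite /chain; elim: (iota 0 5) => //= j s IH; rewrite -IH -cat_cons mem_cat.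
Qed.

Lemma mem_chainP (T : eqType) (z : nat -> T) k x :
  reflect (exists2 j, j < 5 & x \in z j :: k j) (x \in chain z k).
Proof.
rewrite mem_chain; apply: (iffP hasP) => -[j j5 xj]; exists j => //.
  by move: j5; rewrite mem_iota.
by rewrite mem_iota.
Qed.

Lemma chain_uniq_link (T : eqType) (z : nat -> T) k j :
  uniq (chain z k) -> j < 5 -> uniq (z j :: k j).
Proof.
rewrite /chain => U lt5; have : j \in iota 0 5 by rewrite mem_iota.
have flatS a s : flatten [seq z j :: k j | j <- a :: s] =
    (z a :: k a) ++ flatten [seq z j :: k j | j <- s] by [].
elim: (iota 0 5) U => // a s IH; rewrite flatS cat_uniq => /and3P [Ua _ Us].
by rewrite in_cons => /predU1P [->|/IH]; [| apply].
Qed.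

Lemma chain_uniq (T : eqType) (z : nat -> T) k i j x :
  uniq (chain z k) -> i < 5 -> j < 5 ->
  x \in z i :: k i -> x \in z j :: k j -> i = j.
Proof.
rewrite /chain => U i5 j5 xi xj.
have : i \in iota 0 5 by rewrite mem_iota.
have : j \in iota 0 5 by rewrite mem_iota.
have flatS a s : flatten [seq z j :: k j | j <- a :: s] =
    (z a :: k a) ++ flatten [seq z j :: k j | j <- s] by [].
elim: (iota 0 5) U => // a s IH; rewrite flatS cat_uniq => /and3P [_ dis Us].
have out b y : b \in s -> y \in z b :: k b -> y \notin z a :: k a.
  move=> bs yb; apply: (hasPn dis); apply/flattenP; exists (z b :: k b) => //.
  exact: map_f.
rewrite !in_cons => /predU1P [ja|js] /predU1P [ia|is_]; first by rewrite ia ja.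
- by move: (out _ _ is_ xi); rewrite -ja xj.
- by move: (out _ _ js xj); rewrite -ia xi.
- exact: IH.
Qed.

Lemma cycle_in_spanning (G : sgraph) (F : {set {set G}}) (c : seq G) :
  is_cycle c -> cycle_edges c \subset F ->
  cycle (@adj (spanning_subgraph F)) c.
Proof.
move=> /and3P [_ cc cu] /subsetP sub; apply: cycle_from_next => // x xc.
rewrite /= (next_cycle cc xc) sub //; apply/imsetP; by exists x.
Qed.

(** The spoke at [z i] ends at position [3 * i] of the second cycle, so two
    steps of the index [i] are one step along that cycle, as in the inner
    pentagram. *)
Lemma petersen_of_chains (G : sgraph) (M : {set {set G}}) z k z' k' :
  perfect_matching M -> two_cycles M (chain z k) (chain z' k') ->
  (forall i, i < 5 -> z' (3 * i %% 5) = mate M (z i)) ->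
  exists F, [/\ M_petersen_copy M F, edges G :\: M \subset F &
                [set z 0; mate M (z 0)] \in F].
Proof.
move=> pm tc zz'; have [[cy cy'] dis cov EM _] := tc.
have /and3P [_ _ cu] := cy; have /and3P [_ _ cu'] := cy'.
pose N := [set [set z i; mate M (z i)] | i : 'I_5].
pose F := (edges G :\: M) :|: N.
have NF i : i < 5 -> [set z i; mate M (z i)] \in N.
  by move=> i5; apply/imsetP; exists (Ordinal i5).
have cF : cycle (@adj (spanning_subgraph F)) (chain z k).
  by apply: cycle_in_spanning => //; rewrite /F EM -setUA subsetUl.
have cF' : cycle (@adj (spanning_subgraph F)) (chain z' k').
  by apply: cycle_in_spanning => //; rewrite /F EM setUAC subsetUr.
have zc i : i < 5 -> z i \in chain z k.
  by move=> i5; apply/mem_chainP; exists i; rewrite ?mem_head.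
have mod5 m : m %% 5 < 5 by rewrite ltn_mod.
exists F; split; [split | exact: subsetUl | by rewrite in_setU NF ?orbT].
  exists N; split=> //.
    by apply/subsetP => e /imsetP [i _ ->]; apply: mate_edge.
  rewrite card_imset ?card_ord // => i j /set2_eq [[E _]|[E _]].
    apply/val_inj/(chain_uniq (x := z i) cu); rewrite ?mem_head //=.
    by rewrite E mem_head.
  have := mate_crosses pm tc (zc j (ltn_ord j)).
  by rewrite -E (disjointFr dis) // zc.
(* The place of the Petersen vertex [u] on its cycle. *)
pose pos (u : petersen) := if u.1 then 3 * u.2 %% 5 else u.2 : nat.
pose B (u : petersen) := if u.1 then z' (pos u) else z (pos u).
pose L (u : petersen) := if u.1 then k' (pos u) else k (pos u).
have pos5 u : pos u < 5 by rewrite /pos; case: ifP.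
have pos_next u : pos (rim_next u) = (pos u).+1 %% 5.
  case: u => a [i lti]; rewrite /pos /rim_next /=.
  by case: a; case: i lti => [|[|[|[|[|i]]]]] lti //.
have pos_inj a i j : pos (a, i) = pos (a, j) -> i = j.
  case: i j => i lti [j ltj] E; apply: val_inj; move: E; rewrite /pos /=.
  by case: a => //; case: i lti => [|[|[|[|[|i]]]]] lti //;
     case: j ltj => [|[|[|[|[|j]]]]] ltj //.
have next1 u : (rim_next u).1 = u.1 by [].
have inblk u x : (x \in B u :: L u) =
    if u.1 then x \in z' (pos u) :: k' (pos u) else x \in z (pos u) :: k (pos u).
  by rewrite /B /L; case: ifP.
have inc u x : x \in B u :: L u -> x \in if u.1 then chain z' k' else chain z k.
  rewrite inblk; case: ifP => _ h; apply/mem_chainP; by exists (pos u).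
have pos_surj a j : j < 5 -> exists i, pos (a, i) = j.
  rewrite /pos; case: a => /= j5; last by exists (Ordinal j5).
  (* 2 is the inverse of 3 modulo 5. *)
  exists (Ordinal (mod5 (2 * j))) => /=.
  by case: j j5 => [|[|[|[|[|j]]]]] j5 //.
apply: (@petersen_subdivision (spanning_subgraph F) B L).
- move=> u; rewrite /B /L next1 pos_next.
  by case: u.1; apply: chain_path.
- move=> i; rewrite /B /= /pos /= zz' // mate_adj //=.
  by rewrite in_setU NF ?orbT.
- by move=> u; rewrite /B /L; case: u.1; apply: chain_uniq_link.
- move=> [a i] [b j] x xu xv; have := inc _ _ xu; have := inc _ _ xv.
  move: xu xv; rewrite !inblk /=.
  case: a b => [] [] xi xj; last 1 first.
  + by move=> _ _; rewrite (pos_inj false i j) //; apply: chain_uniq xi xj.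
  + by move=> _ _; rewrite (pos_inj true i j) //; apply: chain_uniq xi xj.
  + by move=> h; rewrite (disjointFr dis h).
  + by move=> h; rewrite (disjointFl dis h).
- move=> x; case/orP: (cov x) => /mem_chainP [j j5 xj].
    have [i Ei] := pos_surj false _ j5.
    by exists (false, i); rewrite inblk Ei.
  have [i Ei] := pos_surj true _ j5.
  by exists (true, i); rewrite inblk Ei.
- move=> e /edgeP [x [y [/= /andP [_ xyF] Ee]]].
  move: xyF; rewrite -{}Ee /F EM !in_setU => /orP [/orP [] |/imsetP [i _ ->]].
  + move/chain_walk=> [j j5 ej]; left; have [i Ei] := pos_surj false _ j5.
    by exists (false, i); rewrite /B /L next1 pos_next Ei.
  + move/chain_walk=> [j j5 ej]; left; have [i Ei] := pos_surj true _ j5.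
    by exists (true, i); rewrite /B /L next1 pos_next Ei.
  + by right; exists i; rewrite /B /pos /= zz'.
Qed.

(** * The spokes as a permutation *)

Lemma split_at (T : eqType) (s : seq T) a : uniq s -> a \in s ->
  exists l r, s = l ++ a :: r /\
    forall b, b \in s -> index a s < index b s ->
      b \in r /\ index b s = size l + (index b r).+1.
Proof.
move=> U /splitPr h; case: h U => l r U; exists l, r; split=> // b bs.
have aNl : a \notin l.
  by move: U; rewrite cat_uniq /= negb_or => /and3P [_ /andP [] ].
rewrite !index_cat (negbTE aNl) /= eqxx addn0.
case: ifP => bl; first by have := index_mem b l; rewrite bl; lia.
move: bs; rewrite mem_cat bl in_cons /=.
by case: (eqVneq b a) => _ /=; lia.
Qed.

Lemma split_at4 (T : eqType) (s : seq T) a b c d : uniq s ->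
  a \in s -> b \in s -> c \in s -> d \in s ->
  index a s < index b s -> index b s < index c s -> index c s < index d s ->
  exists l0 l1 l2 l3 l4,
    s = l0 ++ a :: l1 ++ b :: l2 ++ c :: l3 ++ d :: l4.
Proof.
move=> U sa sb sc sd ab bc cd.
have [l0 [r0 [E0 h0]]] := split_at U sa.
have [rb ib] := h0 _ sb ab; have [rc ic] := h0 _ sc (ltn_trans ab bc).
have [rd id_] := h0 _ sd (ltn_trans ab (ltn_trans bc cd)).
have U0 : uniq r0 by move: U; rewrite E0 cat_uniq /= => /and4P [].
have bc0 : index b r0 < index c r0 by lia.
have cd0 : index c r0 < index d r0 by lia.
have [l1 [r1 [E1 h1]]] := split_at U0 rb.
have [rc1 ic1] := h1 _ rc bc0; have [rd1 id1] := h1 _ rd (ltn_trans bc0 cd0).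
have U1 : uniq r1 by move: U0; rewrite E1 cat_uniq /= => /and4P [].
have cd1 : index c r1 < index d r1 by lia.
have [l2 [r2 [E2 h2]]] := split_at U1 rc1.
have [rd2 _] := h2 _ rd1 cd1.
have [l3 [l4 E3]] : exists l3 l4, r2 = l3 ++ d :: l4.
  by case/splitPr: rd2 => l3 l4; exists l3, l4.
by exists l0, l1, l2, l3, l4; rewrite E0 E1 E2 E3.
Qed.

Lemma filter_prefix (T : eqType) (P : pred T) (s : seq T) : uniq s ->
  {in s &, forall x y, P x -> ~~ P y -> index x s < index y s} ->
  s = filter P s ++ filter (predC P) s.
Proof.
elim: s => // x s IH; rewrite cons_uniq => /andP [xNs U] h /=.
have shift y : y \in s -> index y (x :: s) = (index y s).+1.
  by move=> ys /=; case: eqP => // e; rewrite e ys in xNs.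
case: ifP => Px /=.
  rewrite -IH // => y z ys zs Py Pz.
  by have := h y z; rewrite !shift ?in_cons ?ys ?zs ?orbT //; apply.
have no y : y \in s -> ~~ P y.
  move=> ys; apply/negP => Py; have := h y x.
  by rewrite !in_cons ys eqxx orbT Px /= eqxx ltn0 => /(_ isT isT Py isT).
have -> : filter P s = [::].
  by apply/eqP; rewrite -(negbK (_ == _)) -has_filter; apply/hasPn.
by congr cons; apply/esym/all_filterP/allP.
Qed.

Lemma two_cycles_swap2 (G : sgraph) (M : {set {set G}}) c1 p q :
  two_cycles M c1 (p ++ q) -> two_cycles M c1 (q ++ p).
Proof.
move=> tc; apply: two_cycles_same (tc); rewrite -(rot_size_cat p q).
by apply: same_cycle_rot; case: tc => -[].
Qed.

Lemma two_cycles_swap1 (G : sgraph) (M : {set {set G}}) p q c2 :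
  two_cycles M (p ++ q) c2 -> two_cycles M (q ++ p) c2.
Proof. by move/two_cycles_sym/two_cycles_swap2/two_cycles_sym. Qed.

Lemma two_cycles_rev2 (G : sgraph) (M : {set {set G}}) c1 y s :
  two_cycles M c1 (y :: s) -> two_cycles M c1 (y :: rev s).
Proof.
move=> tc; apply: (@two_cycles_swap2 _ _ _ (rev s) [:: y]).
rewrite cats1 -rev_cons; apply: two_cycles_same (tc).
by apply: same_cycle_rev; case: tc => -[].
Qed.

(** The value of the spoke at [x] in the permutation. *)
Definition mate_index (G : sgraph) (M : {set {set G}}) (s2 : seq G) (x : G) :=
  index (mate M x) s2.

Lemma mate_in_tail (G : sgraph) (M : {set {set G}}) x0 s1 s2 :
  perfect_matching M -> two_cycles M (x0 :: s1) (mate M x0 :: s2) ->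
  {in s1, forall x, mate M x \in s2}.
Proof.
move=> pm tc x xs.
have := mate_crosses (x := x) pm tc; rewrite !in_cons xs orbT => /(_ isT).
case: eqP => // /(inv_inj (mateK pm)) E; case: tc => -[/and3P [_ _ U] _] _ _ _ _.
by move: U; rewrite /= -E xs.
Qed.

(** The blocks are prefixes and suffixes on both paths, that is, arcs.  There
    are at least four spokes besides the one at [x0], so one block has at least
    two of them; [x0] is added to the other block. *)
Lemma block_sum_absurd (G : sgraph) (M : {set {set G}}) x0 s1 s2 :
  perfect_matching M -> cyclically_edge_connected 5 G ->
  two_cycles M (x0 :: s1) (mate M x0 :: s2) ->
  ~ block_sum (index^~ s1) (mate_index M s2) [set x in s1].
Proof.
move=> pm conn tc [s [A [B [EAB A0 B0 AB]]]].
have s1s2 := mate_in_tail pm tc.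
have s2s1 : {in s2, forall y, mate M y \in s1}.
  by apply: (@mate_in_tail _ M (mate M x0)); rewrite // mateK //;
     apply: two_cycles_sym.
have [/= U1 U2] : uniq s1 /\ uniq s2.
  by case: (tc) => -[/and3P [_ _ /andP [_ U]] /and3P [_ _ /andP [_ U']]].
have inS x : (x \in s1) = (x \in A) || (x \in B).
  by rewrite -in_setU EAB inE.
have NAB x : x \in A -> x \notin B.
  by move=> Ax; apply/negP => Bx; have [] := AB _ _ Ax Bx; rewrite ltnn.
have BA x : x \in s1 -> x \notin A -> x \in B.
  by rewrite inS => /orP [->|].
pose a := filter (mem A) s1; pose b := filter (predC (mem A)) s1.
have E1 : s1 = a ++ b.
  apply: filter_prefix => // x y xs ys Ax Ay.
  by have [] := AB x y Ax (BA y ys Ay).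
pose P y := mate M y \in A.
pose a' := filter P s2; pose b' := filter (predC P) s2.
have aa' : {in a, forall x, mate M x \in a'}.
  move=> x; rewrite !mem_filter => /andP [Ax xs].
  by rewrite /P mateK // s1s2 // andbT.
have bb' : {in b, forall x, mate M x \in b'}.
  move=> x; rewrite !mem_filter => /andP [Bx xs].
  by rewrite /P /= /P mateK // s1s2 // andbT.
have E2 : s2 = if s then a' ++ b' else b' ++ a'.
  have lt y z : y \in s2 -> z \in s2 -> P y -> ~~ P z ->
      ord_lt s (index y s2) (index z s2).
    move=> ys zs Py Pz; have [_] := AB _ _ Py (BA _ (s2s1 _ zs) Pz).
    by rewrite /mate_index !mateK.
  case: (s) lt => lt; first exact: filter_prefix.
  rewrite /a' -(eq_filter (a1 := predC (predC P))); last first.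
    by move=> y; rewrite /= negbK.
  apply: filter_prefix => // y z ys zs Py; rewrite /= negbK => Pz.
  exact: lt.
have a0 : 0 < size a.
  have [x Ax] := set0Pn _ A0; have : x \in a by rewrite mem_filter inS /= Ax.
  by case: (a).
have b0 : 0 < size b.
  have [x Bx] := set0Pn _ B0.
  have : x \in b.
    rewrite mem_filter inS Bx orbT andbT /=.
    by apply: contraL Bx; apply: NAB.
  by case: (b).
have := long_cycles pm conn tc; rewrite /= E1 size_cat => big.
(* Reversing the second cycle turns a skew sum into a direct sum. *)
have [t [t' [tc' at_ bt']]] : exists t t',
    [/\ two_cycles M (x0 :: a ++ b) (mate M x0 :: t ++ t'),
        {in a, forall x, mate M x \in t} & {in b, forall x, mate M x \in t'}].
  move: tc; rewrite E1 E2; case: (s) => tc'; first by exists a', b'.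
  exists (rev a'), (rev b'); split; last 2 first.
  - by move=> x /aa'; rewrite mem_rev.
  - by move=> x /bb'; rewrite mem_rev.
  by rewrite -rev_cat; apply: two_cycles_rev2.
have extend p p' : {in p, forall x, mate M x \in p'} ->
    {in x0 :: p, forall x, mate M x \in mate M x0 :: p'}.
  by move=> pp' x; rewrite !in_cons => /predU1P [->|/pp' ->];
     rewrite ?eqxx ?orbT.
have [b2|b1] := ltnP 1 (size b).
  rewrite -!cat_cons in tc'.
  by apply: (arcs_not_matched pm conn tc') => //; apply: extend.
have := tc'; rewrite -(cat1s x0) -(cat1s (mate M x0)).
move=> /two_cycles_swap1/two_cycles_swap2; rewrite -!catA => tc''.
apply: (arcs_not_matched pm conn tc'') => //.
- by move: big; lia.
- by rewrite size_cat addn1 ltnS.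
by move=> x; rewrite !cats1 !mem_rcons; apply: extend.
Qed.

(** With the spoke at [x0] in place 0, the spokes 0, 1, 2, 3, 4 in the order of
    the first cycle appear as 0, 2, 4, 1, 3 on the second one. *)
Lemma pattern_petersen (G : sgraph) (M : {set {set G}}) x0 s1 s2 :
  perfect_matching M -> two_cycles M (x0 :: s1) (mate M x0 :: s2) ->
  crossing_pattern (index^~ s1) (mate_index M s2) [set x in s1] ->
  exists F, [/\ M_petersen_copy M F, edges G :\: M \subset F &
                [set x0; mate M x0] \in F].
Proof.
move=> pm tc [s [p1 [p2 [p3 [p4 []]]]]].
rewrite !inE => -[P1 P2 P3 P4] [lt12 lt23 lt34] [v24 v41 v13].
have [U1 U2] : uniq s1 /\ uniq s2.
  by case: (tc) => -[/and3P [_ _ /andP [_ U]] /and3P [_ _ /andP [_ U']]].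
have in2 := mate_in_tail pm tc.
have [l0 [l1 [l2 [l3 [l4 E1]]]]] := split_at4 U1 P1 P2 P3 P4 lt12 lt23 lt34.
have [r0 [r1 [r2 [r3 [r4 tc']]]]] : exists r0 r1 r2 r3 r4,
    two_cycles M (x0 :: s1) (mate M x0 :: r0 ++ mate M p2 :: r1 ++
      mate M p4 :: r2 ++ mate M p1 :: r3 ++ mate M p3 :: r4).
  case: s v24 v41 v13 => /= v24 v41 v13.
    have [r0 [r1 [r2 [r3 [r4 E2]]]]] :=
      split_at4 U2 (in2 _ P2) (in2 _ P4) (in2 _ P1) (in2 _ P3) v24 v41 v13.
    by exists r0, r1, r2, r3, r4; rewrite -E2.
  (* The values decrease: traverse the second cycle backwards. *)
  have [r0 [r1 [r2 [r3 [r4 E2]]]]] :=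
    split_at4 U2 (in2 _ P3) (in2 _ P1) (in2 _ P4) (in2 _ P2) v13 v41 v24.
  exists (rev r4), (rev r3), (rev r2), (rev r1), (rev r0).
  have := two_cycles_rev2 tc; rewrite E2.
  by rewrite !(rev_cat, rev_cons, cat_rcons, rcons_cat, rcons_cons, catA) -?catA.
pose z i := nth x0 [:: x0; p1; p2; p3; p4] i.
pose k i := nth [::] [:: l0; l1; l2; l3; l4] i.
pose z' i := mate M (nth x0 [:: x0; p2; p4; p1; p3] i).
pose k' i := nth [::] [:: r0; r1; r2; r3; r4] i.
apply: (@petersen_of_chains G M z k z' k') => //.
  by rewrite !chainE /z /z' /k /k' /= -E1.
by case=> [|[|[|[|[|i]]]]].
Qed.

Lemma spoke_in_petersen (G : sgraph) (M : {set {set G}}) c1 c2 x0 :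
  perfect_matching M -> cyclically_edge_connected 5 G ->
  two_cycles M c1 c2 -> x0 \in c1 ->
  exists F, [/\ M_petersen_copy M F, edges G :\: M \subset F &
                [set x0; mate M x0] \in F].
Proof.
move=> pm conn tc0 x0c.
have [i s1 E1] := rot_to x0c.
have [j s2 E2] := rot_to (mate_crosses pm tc0 x0c).
have tc : two_cycles M (x0 :: s1) (mate M x0 :: s2).
  rewrite -E1 -E2; have [[cy cy'] _ _ _ _] := tc0.
  apply: (two_cycles_same (same_cycle_rot j cy')); apply: two_cycles_sym.
  by apply: (two_cycles_same (same_cycle_rot i cy)); apply: two_cycles_sym.
have in2 := mate_in_tail pm tc.
have [||||] := @pattern_or_block_sum _ (index^~ s1) (mate_index M s2)
    [set x in s1].
- by move=> x y; rewrite !inE => xs ys; apply: index_inj.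
- move=> x y; rewrite !inE => xs ys E; apply: (inv_inj (mateK pm)).
  exact: index_inj (in2 _ xs) (in2 _ ys) E.
- rewrite cardsE; have := long_cycles pm conn tc.
  case: (tc) => -[/and3P [_ _ /andP [_ U]] _] _ _ _ _.
  by rewrite (card_uniqP U) /=; lia.
- exact: pattern_petersen.
by move/(block_sum_absurd pm conn tc).
Qed.

Theorem corollary3 (G : sgraph) (M : {set {set G}})
  (hGM : marked_permutation_graph M)
  (hconn : cyclically_edge_connected 5 G) :
  forall e : {set G}, e \in edges G ->
    exists F : {set {set G}}, M_petersen_copy M F /\ e \in F.
Proof.
move=> e eE; have [_ pm [c1 [c2 tc]]] := hGM.
have {}tc : two_cycles M c1 c2 := tc.
have [eM|eM] := boolP (e \in M); last first.
  have [x xc] : exists x, x \in c1.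
    by case: tc => -[cy _] _ _ _ _; case: (c1) cy => // x c _;
       exists x; rewrite mem_head.
  have [F [PF /subsetP sub _]] := spoke_in_petersen pm hconn tc xc.
  by exists F; split=> //; apply: sub; rewrite in_setD eM.
have [[x xc ->]|ec|ec] := edge_cases pm tc eE.
- by have [F [PF _ xF]] := spoke_in_petersen pm hconn tc xc; exists F.
- have : e \in edges G :\: M by case: tc => _ _ _ -> _; rewrite in_setU ec.
  by rewrite in_setD eM.
- have : e \in edges G :\: M.
    by case: tc => _ _ _ -> _; rewrite in_setU ec orbT.
  by rewrite in_setD eM.
Qed.
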